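(* Let $p$ be a homogeneous polynomial on $\mathbb{R}^n$ that is hyperbolic with respect to $e\in\mathbb{R}^n$. Then its hyperbolicity cone $\Lambda_+(p,e)$ is amenable; that is, for every nonempty face $\mathcal{F}$ of $\Lambda_+(p,e)$ there exists a constant $\kappa>0$ such that $$\operatorname{dist}(x,\mathcal{F})\le \kappa\,\operatorname{dist}(x,\Lambda_+(p,e))\quad\text{for all } x\in\operatorname{span}(\mathcal{F}).$$
   Context: A homogeneous polynomial $p$ of degree $d$ in $n$ real variables (real coefficients) is hyperbolic with respect to $e\in\mathbb{R}^n$ if $p(e)>0$ and, for each $x\in\mathbb{R}^n$, the univariate polynomial $t\mapsto p(te-x)$ has only real zeros. Its (closed) hyperbolicity cone is $\Lambda_+(p,e)=\{x\in\mathbb{R}^n : \text{all zeros of } t\mapsto p(te-x) \text{ are nonnegative}\}$, which is a closed convex cone. A face of a closed convex set $C\subseteq\mathbb{R}^n$ is a closed convex set $\mathcal{F}\subseteq C$ such that whenever $x,y\in C$ satisfy $\alpha x+(1-\alpha)y\in\mathcal{F}$ for some $\alpha\in(0,1)$, then $x,y\in\mathcal{F}$. The space $\mathbb{R}^n$ is equipped with some norm $\|\cdot\|$ and $\operatorname{dist}(x,C)=\inf\{\|x-y\| : y\in C\}$. *)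

(* Defs.v *)
From HB Require Import structures.
From mathcomp Require Import all_boot all_order all_algebra.
From mathcomp Require mpoly.
(* The notations of mpoly clash with those of mathcomp-analysis. *)
Import -(notations) mpoly.
From mathcomp Require Import all_classical all_reals all_analysis.
From mathcomp Require Import complex.

Set Implicit Arguments.
Unset Strict Implicit.
Unset Printing Implicit Defensive.

Import Order.TTheory GRing.Theory Num.Theory.
Import numFieldNormedType.Exports.

Local Open Scope classical_set_scope.
Local Open Scope ring_scope.

(* R^n is 'rV[R]_n; its topology is the library's (sup-norm) topology, which is
   also the topology of every norm. *)

Definition homogeneous (R : realType) (n d : nat) (p : mpoly n R) : Prop :=
  p \is ishomog1 d mdeg.

Definition evalp (R : realType) (n : nat) (p : mpoly n R)
    (x : 'rV[R]_n) : R :=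
  meval (fun i => x 0 i) p.

(* The univariate polynomial t |-> p(t e - x): the i-th variable of p is
   replaced by the polynomial e_i 'X - x_i. *)
Definition line_poly (R : realType) (n : nat) (p : mpoly n R)
    (e x : 'rV[R]_n) : {poly R} :=
  mmap polyC (fun i => e 0 i *: 'X - (x 0 i)%:P) p.

Lemma line_polyE (R : realType) (n : nat) (p : mpoly n R)
    (e x : 'rV[R]_n) (t : R) :
  (line_poly p e x).[t] = evalp p (t *: e - x).
Proof.
rewrite /line_poly /evalp mevalE /mmap horner_sum.
apply: eq_bigr => m _; rewrite hornerM hornerC; congr (_ * _).
rewrite /mmap1 horner_prod; apply: eq_bigr => i _.
by rewrite horner_exp !hornerE !mxE mulrC.
Qed.

(* z is a complex zero of t |-> p(t e - x). *)
Definition line_zero (R : realType) (n : nat) (p : mpoly n R)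
    (e x : 'rV[R]_n) (z : R[i]) : Prop :=
  root (map_poly (real_complex R) (line_poly p e x)) z.

Definition hyperbolic (R : realType) (n : nat) (p : mpoly n R)
    (e : 'rV[R]_n) : Prop :=
  0 < evalp p e /\
  forall (x : 'rV[R]_n) (z : R[i]), line_zero p e x z -> z \is Num.real.

(* In the order of R[i], 0 <= z means that z is real and nonnegative. *)
Definition hyperbolicity_cone (R : realType) (n : nat) (p : mpoly n R)
    (e : 'rV[R]_n) : set 'rV[R]_n :=
  [set x | forall z : R[i], line_zero p e x z -> 0 <= z].

Definition face (R : realType) (n : nat) (C F : set 'rV[R]_n) : Prop :=
  [/\ closed F, convex_set F, F `<=` C &
    forall (x y : 'rV[R]_n) (a : R), C x -> C y -> 0 < a -> a < 1 ->
      F (a *: x + (1 - a) *: y) -> F x /\ F y].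

Definition is_norm (R : realType) (n : nat) (N : 'rV[R]_n -> R) : Prop :=
  [/\ forall x, 0 <= N x,
      forall x, N x = 0 -> x = 0,
      forall (a : R) x, N (a *: x) = `|a| * N x &
      forall x y, N (x + y) <= N x + N y].

(* Only meaningful for nonempty C: inf set0 = 0. *)
Definition dist (R : realType) (n : nat) (N : 'rV[R]_n -> R) (x : 'rV[R]_n)
    (C : set 'rV[R]_n) : R :=
  inf [set N (x - y) | y in C].

(* Vectors in the linear span of a finite family of elements of A. *)
Definition set_span (R : realType) (n : nat) (A : set 'rV[R]_n) :
    set 'rV[R]_n :=
  [set v | exists2 s : seq 'rV[R]_n,
     (forall y, y \in s -> A y) & v \in span s].

Definition amenable (R : realType) (n : nat) (N : 'rV[R]_n -> R)
    (C : set 'rV[R]_n) : Prop :=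
  forall F : set 'rV[R]_n, face C F -> F !=set0 ->
    exists2 kappa : R, 0 < kappa &
      forall x, set_span F x -> dist N x F <= kappa * dist N x C.

(* Main.v *)
(* The eigenvalues of x are the zeros of t |-> p (t e - x).  Let z minimize the
   multiplicity m of the eigenvalue 0 over the face F, and write x in span F as
   a - b with a, b in F.  Since t ^ m divides p (u a + r b + s z + t e) for all
   u, r, s >= 0, it divides it identically (polynomial continuation), so taking
   r = - u gives p (u x + s z + t e) = t ^ m Q (u, s, t), where Q is again
   hyperbolic with respect to e and Q (z) <> 0.  If x + e lies in the cone and mu
   is below the positive eigenvalues of z, then x + e and z - mu e lie in the cone
   of Q, which is convex (Garding), hence mu x + z lies in it, and therefore in F:
   the constant 1 / mu does not depend on x.  As e is interior to the cone, x + c e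
   lies in the cone for some c proportional to dist (x, cone), and
   homogeneity then bounds dist (x, F) by a multiple of c.

   Garding's theorem is obtained by following complex roots of polynomials along a
   homotopy: roots that never become real stay in their half-plane. *)

Require Import Defs.
From mathcomp Require Import all_boot all_order all_algebra.
From mathcomp Require mpoly.
Import -(notations) mpoly.
From mathcomp Require Import all_classical all_reals all_analysis.
From mathcomp Require Import complex ring lra.

Set Implicit Arguments.
Unset Strict Implicit.
Unset Printing Implicit Defensive.

Import Order.TTheory GRing.Theory Num.Theory.
Import numFieldNormedType.Exports.

Local Open Scope classical_set_scope.
Local Open Scope ring_scope.
Local Open Scope complex_scope.

(** * Roots of a family of polynomials *)

(** Connectedness of [0, 1]: [P] is locally constant there, so it holds at the supremum of the
    points where it holds, and this supremum cannot lie below 1. *)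
Lemma unit_interval_induction (R : realType) (P : R -> Prop) :
  P 0 ->
  (forall s, 0 <= s <= 1 -> exists2 eps : R, 0 < eps &
     forall t, 0 <= t <= 1 -> `|t - s| < eps -> P s <-> P t) ->
  P 1.
Proof.
move=> P0 Ploc; pose S := [set s | 0 <= s <= 1 /\ P s].
have S0 : S 0 by split; rewrite ?lexx ?ler01.
have supS : has_sup S.
  by split; [exists 0 | exists 1 => s [/andP[]]].
have s01 : 0 <= sup S <= 1.
  rewrite ub_le_sup //=; last by case: supS.
  by apply: ge_sup; [exists 0 | move=> s [/andP[]]].
have [eps eps0 Peps] := Ploc _ s01.
have Psup : P (sup S).
  have [s [s01' Ps] lts] := sup_adherent eps0 supS.
  apply/(Peps s) => //; rewrite distrC ger0_norm ?subr_ge0 ?ltrBlDr -?ltrBlDl //.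
  by apply: ub_le_sup => //; case: supS.
case/andP: (s01) => s0 s1.
case: (ltP (sup S + eps / 2) 1) => [lt1|ge1].
  have : S (sup S + eps / 2).
    have t01 : 0 <= sup S + eps / 2 <= 1 by lra.
    split=> //; apply/(Peps _ t01) => //.
    by rewrite addrAC subrr add0r gtr0_norm; lra.
  move/(ub_le_sup (proj2 supS)); lra.
by apply/(Peps 1) => //; rewrite ?ler01 ?lexx // ger0_norm; lra.
Qed.

Section RootLocation.
Variable R : realType.
Local Notation C := R[i].
Implicit Types (f g : {poly C}) (s z : C).

Lemma norm_horner_sub_le D f g s (eps : C) :
  (size f <= D.+1)%N -> (size g <= D.+1)%N ->
  (forall k, `|f`_k - g`_k| <= eps) ->
  `|f.[s] - g.[s]| <= eps * ((1 + `|s|) ^+ D *+ D.+1).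
Proof.
move=> sf sg fg.
rewrite -hornerN -hornerD (@horner_coef_wide _ D.+1); last first.
  by rewrite (leq_trans (size_polyD _ _)) // size_polyN geq_max sf.
apply: le_trans (ler_norm_sum _ _ _) _.
have <- : \sum_(k < D.+1) (1 + `|s|) ^+ D = (1 + `|s|) ^+ D *+ D.+1.
  by rewrite sumr_const card_ord.
rewrite mulr_sumr ler_sum // => k _.
rewrite normrM coefB normrX ler_pM // ?exprn_ge0 //.
apply: (@le_trans _ _ ((1 + `|s|) ^+ k)).
  by rewrite lerXn2r ?nnegrE ?lerDr ?addr_ge0 ?ler01.
by apply: ler_weXn2l; [rewrite lerDl | rewrite -ltnS].
Qed.

(** Factor [f] into linear factors. The lower bound [r] for the distance from [s] to a root may vary
    with the root, which serves both uses below. *)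
Lemma norm_horner_ge f : exists rs : seq C,
  [/\ size rs = (size f).-1, all (root f) rs &
   forall (r : C -> C) s, (forall z, root f z -> 0 <= r z <= `|s - z|) ->
    `|lead_coef f| * \prod_(z <- rs) r z <= `|f.[s]|].
Proof.
have [->|f0] := eqVneq f 0.
  exists [::]; rewrite ?size_poly0 //; split=> // r s _.
  by rewrite lead_coef0 normr0 mul0r normr_ge0.
have [rs Ef] := closed_field_poly_normal f.
have rsP : all (root f) rs.
  apply/allP => z zrs; rewrite Ef rootZ ?lead_coef_eq0 //.
  by rewrite root_prod_XsubC.
exists rs; split=> // [|r s hr].
  by rewrite Ef size_scale ?lead_coef_eq0 // size_prod_XsubC.
rewrite [in leRHS]Ef hornerZ normrM ler_wpM2l // horner_prod normr_prod.
elim: rs rsP {Ef} => [|z rs IH]; first by rewrite !big_nil.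
case/andP => /hr/andP[r0 rz] /[dup] rsP /IH {}IH; rewrite !big_cons ler_pM //.
  by rewrite big_seq prodr_ge0 // => y /(allP rsP)/hr/andP[].
by rewrite !hornerE.
Qed.

Lemma norm_ge_Im s : `|complex.Im s|%:C <= `|s|.
Proof.
rewrite normc_def lecR -sqrtr_sqr ler_sqrt ?addr_ge0 ?sqr_ge0 //.
by rewrite lerDr sqr_ge0.
Qed.

Lemma norm_sub_ge_Im s z :
  (complex.Im s - complex.Im z)%:C <= `|s - z|.
Proof.
apply: le_trans (norm_ge_Im _).
have -> : complex.Im (s - z) = complex.Im s - complex.Im z.
  by case: s z => [a b] [c d].
by rewrite lecR ler_norm.
Qed.

Lemma exists_small (a b : C) : 0 < a -> 0 < b ->
  exists2 eps : C, 0 < eps & eps * b < a.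
Proof.
move=> a0 b0; exists (a / b / 2); first by rewrite !divr_gt0.
by rewrite mulrAC divfK ?gt_eqF // ltr_pdivrMr // ltr_pMr // ltr1n.
Qed.

(** If all roots of [g] lay in the lower half-plane, each would be at distance at least Im s from
    [s], so |g(s)| >= |c| (Im s)^D; but f(s) = 0 makes |g(s)| small. *)
Lemma root_upper_closed D (c : C) f s : c != 0 ->
  (size f <= D.+1)%N -> root f s -> 0 < complex.Im s ->
  exists2 eps : C, 0 < eps & forall g, (size g <= D.+1)%N -> g`_D = c ->
    (forall k, `|f`_k - g`_k| <= eps) ->
    ~ (forall z, root g z -> complex.Im z < 0).
Proof.
move=> c0 sf /eqP fs s0.
have [||eps eps0 epsP] := @exists_small (`|c| * (complex.Im s)%:C ^+ D)
  ((1 + `|s|) ^+ D *+ D.+1).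
- by rewrite mulr_gt0 ?normr_gt0 // exprn_gt0 // ltcR.
- by rewrite pmulrn_rgt0 // exprn_gt0 // ltr_wpDr.
exists eps => // g sg gD fg groots.
have sgE : size g = D.+1.
  apply/eqP; rewrite eqn_leq sg leqNgt; apply/negP => lt.
  by move/eqP: c0; apply; rewrite -gD nth_default.
have [rs [srs rsP hrs]] := norm_horner_ge g.
have /hrs : forall z, root g z -> 0 <= (complex.Im s)%:C <= `|s - z|.
  move=> z /groots z0; rewrite lecR (ltW s0) /=.
  by apply: le_trans (norm_sub_ge_Im s z); rewrite lecR lerDl oppr_ge0 ltW.
rewrite lead_coefE sgE gD big_const_seq count_predT srs sgE /= iter_mulr_1.
move=> le1; have := norm_horner_sub_le s sf sg fg.
rewrite fs sub0r normrN => /(le_trans le1)/le_lt_trans/(_ epsP).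
by rewrite ltxx.
Qed.

(** The lower bound on |f(s)| grows like (1 + |s|)^D, as the perturbation bound does, so a single
    [eps] serves the whole closed upper half-plane. *)
Lemma root_lower_open D (c : C) f : c != 0 ->
  (size f <= D.+1)%N -> f`_D = c -> (forall z, root f z -> complex.Im z < 0) ->
  exists2 eps : C, 0 < eps & forall g, (size g <= D.+1)%N ->
    (forall k, `|f`_k - g`_k| <= eps) ->
    forall s, 0 <= complex.Im s -> ~~ root g s.
Proof.
move=> c0 sf fD froots.
have sfE : size f = D.+1.
  apply/eqP; rewrite eqn_leq sf leqNgt; apply/negP => lt.
  by move/eqP: c0; apply; rewrite -fD nth_default.
have [rs [srs rsP hrs]] := norm_horner_ge f.
(* With a = - Im z, both a <= |s - z| and |s| <= |s - z| + |z| hold when Im s >= 0; together they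
   give (1 + |s|) k(z) <= |s - z|. *)
pose k (z : C) : C := (- complex.Im z)%:C / ((- complex.Im z)%:C + 1 + `|z|).
have k0 z : complex.Im z < 0 -> 0 < k z.
  move=> z0; have im0 : 0 < (- complex.Im z)%:C :> C by rewrite ltcR oppr_gt0.
  by rewrite divr_gt0 // ltr_wpDr // addr_gt0.
have [||eps eps0 epsP] := @exists_small (`|c| * \prod_(z <- rs) k z) (D.+1%:R).
- rewrite mulr_gt0 ?normr_gt0 // big_seq prodr_gt0 // => z /(allP rsP)/froots.
  exact: k0.
- by rewrite ltr0n.
exists eps => // g sg fg s s0; apply/negP => /eqP gs.
have /hrs : forall z, root f z -> 0 <= (1 + `|s|) * k z <= `|s - z|.
  move=> z /froots z0; rewrite mulr_ge0 ?addr_ge0 ?(ltW (k0 _ z0)) //=.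
  have im0 : 0 < (- complex.Im z)%:C :> C by rewrite ltcR oppr_gt0.
  rewrite mulrA ler_pdivrMr; last by rewrite ltr_wpDr // addr_gt0.
  have h1 : (- complex.Im z)%:C <= `|s - z|.
    apply: le_trans (norm_sub_ge_Im s z).
    by rewrite lecR lerDr.
  have h2 : `|s| <= `|s - z| + `|z| by rewrite -{1}(subrK z s) ler_normD.
  apply: (@le_trans _ _ ((1 + `|z| + `|s - z|) * (- complex.Im z)%:C)).
    by rewrite ler_wpM2r ?(ltW im0) // -addrA lerD2l addrC.
  rewrite -[in leRHS]addrA mulrDl mulrDr [leRHS]addrC lerD ?[_ * `|s - z|]mulrC //.
  rewrite [leRHS]mulrC.
  by rewrite ler_wpM2l ?addr_ge0.
rewrite lead_coefE sfE fD big_split /= big_const_seq count_predT srs sfE /=.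
rewrite iter_mulr_1 mulrCA => le1.
have := norm_horner_sub_le s sf sg fg; rewrite gs subr0 => /(le_trans le1).
rewrite -[_ *+ D.+1]mulr_natr [leRHS]mulrCA; apply/negP.
by rewrite lt_geF // ltr_pM2l // exprn_gt0 // ltr_wpDr.
Qed.

(** The size bound is proved along with the Lipschitz bound because the induction step multiplies by
    the variable. *)
Lemma horner_lipschitz (g : {poly C}) : exists2 K : C, 0 <= K &
  forall s t : R, 0 <= s <= 1 -> 0 <= t <= 1 ->
    `|g.[s%:C]| <= K /\ `|g.[s%:C] - g.[t%:C]| <= K * `|s - t|%:C.
Proof.
elim/poly_ind: g => [|g c [K K0 hK]].
  by exists 0 => // s t _ _; rewrite !horner0 subr0 normr0 mul0r.
exists (K + K + `|c|) => [|s t s01 t01]; first by rewrite !addr_ge0.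
have [hs hst] := hK s t s01 t01; have [ht _] := hK t s t01 s01.
have normC (x : R) : `|x%:C| = `|x|%:C by rewrite normc_def /= expr0n addr0 sqrtr_sqr.
have le1 (x : R) : 0 <= x <= 1 -> `|x%:C| <= 1.
  by case/andP => x0 x1; rewrite normC lecR ger0_norm.
rewrite !hornerE; split.
  apply: le_trans (ler_normD _ _) _; rewrite lerD2r normrM.
  apply: (@le_trans _ _ K); last by rewrite lerDl.
  by rewrite -[leRHS]mulr1 ler_pM // le1.
have -> : g.[s%:C] * s%:C + c - (g.[t%:C] * t%:C + c) =
    (g.[s%:C] - g.[t%:C]) * s%:C + g.[t%:C] * (s - t)%:C.
  by rewrite rmorphB /=; ring.
apply: le_trans (ler_normD _ _) _; rewrite !normrM (normC (s - t)).
apply: (@le_trans _ _ (K * `|s - t|%:C + K * `|s - t|%:C)).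
  apply: lerD; last by rewrite ler_wpM2r // lecR.
  by rewrite -[leRHS]mulr1 ler_pM // le1.
by rewrite -mulrDl ler_wpM2r ?lecR // lerDl.
Qed.

Lemma coef_lipschitz (F : {poly {poly C}}) : exists2 K : C, 0 <= K &
  forall (s t : R) k, 0 <= s <= 1 -> 0 <= t <= 1 ->
    `|(F`_k).[s%:C] - (F`_k).[t%:C]| <= K * `|s - t|%:C.
Proof.
elim/poly_ind: F => [|F g [K K0 hK]].
  by exists 0 => // s t k _ _; rewrite coef0 !horner0 subr0 normr0 mul0r.
have [L L0 hL] := horner_lipschitz g.
exists (K + L) => [|s t k s01 t01]; first by rewrite addr_ge0.
rewrite coefD coefMX coefC; case: eqP => _.
  rewrite add0r; apply: le_trans (proj2 (hL s t s01 t01)) _.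
  by rewrite ler_wpM2r ?lecR // lerDr.
rewrite addr0; apply: le_trans (hK s t _ s01 t01) _.
by rewrite ler_wpM2r ?lecR // lerDl.
Qed.

(* No root can cross the real axis along the family. *)
Lemma homotopy_roots_lower (F : {poly {poly C}}) D (c : C)
    (f := fun s : R => map_poly (horner_eval s%:C) F) :
  c != 0 ->
  (forall s : R, 0 <= s <= 1 -> (size (f s) <= D.+1)%N /\ (f s)`_D = c) ->
  (forall s x : R, 0 <= s <= 1 -> ~~ root (f s) x%:C) ->
  (forall z, root (f 0) z -> complex.Im z < 0) ->
  forall z, root (f 1) z -> complex.Im z < 0.
Proof.
move=> c0 fD freal f0.
have nreal (s : R) z : 0 <= s <= 1 -> root (f s) z -> complex.Im z != 0.
  move=> s01; apply: contraTneq => z0; rewrite [z]complexE z0 mulr0 addr0.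
  exact: freal.
have [K K0 hK] := coef_lipschitz F.
apply: (@unit_interval_induction R
  (fun s : R => forall z, root (f s) z -> complex.Im z < 0)) => // s s01.
have [sf sD] := fD s s01.
suff [eps eps0 epsP] : exists2 eps : C, 0 < eps &
    forall t, 0 <= t <= 1 -> (forall k, `|(f s)`_k - (f t)`_k| <= eps) ->
      (forall z, root (f s) z -> complex.Im z < 0) <->
      (forall z, root (f t) z -> complex.Im z < 0).
  (* The coefficients are [K]-Lipschitz in the parameter, and [K + 1] is nonzero. [Re] turns a
     positive element of [C] into a real radius. *)
  exists (complex.Re (eps / (K + 1))).
    have : 0 < eps / (K + 1) by rewrite divr_gt0 // ltr_wpDl.
    by rewrite ltcE => /andP[].
  move=> t t01 lt_ts; apply: epsP => // k.
  rewrite !coef_map /= /horner_eval; apply: le_trans (hK s t k s01 t01) _.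
  have er : (complex.Re (eps / (K + 1)))%:C = eps / (K + 1).
    by rewrite RRe_real // ger0_real // divr_ge0 ?(ltW eps0) // addr_ge0.
  have : `|s - t|%:C <= eps / (K + 1) by rewrite -er lecR distrC ltW.
  rewrite ler_pdivlMr ?ltr_wpDl // => /(le_trans _) -> //.
  by rewrite mulrC ler_wpM2l ?lecR // lerDl.
(* The property is open by [root_lower_open]. So is its failure: as no root is real, some root then
   lies in the open upper half-plane, and [root_upper_closed] applies. *)
have [lows|] := pselect (forall z, root (f s) z -> complex.Im z < 0).
  have [eps eps0 epsP] := root_lower_open c0 sf sD lows.
  exists eps => // t t01 fst; split=> // _ z ftz.
  rewrite ltNge; apply/negP => z0.
  by have := epsP _ (proj1 (fD t t01)) fst z z0; rewrite ftz.
move=> /existsNP[z /not_implyP[fz /negP]]; rewrite -leNgt => z0.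
have {}z0 : 0 < complex.Im z by rewrite lt_def z0 andbT (nreal s).
have [eps eps0 epsP] := root_upper_closed c0 sf fz z0.
exists eps => // t t01 fst; split=> [/(_ z fz)|lowt]; first by rewrite ltNge (ltW z0).
by have [sft tD] := fD t t01; case: (epsP _ sft tD fst).
Qed.

End RootLocation.

(** * Polynomial functions of two and three variables *)

(** Only positive integers are tested, because some identities below are checked only away from
    0. *)
Lemma poly_eq0_nat (A : idomainType) (g : {poly A}) :
  injective (fun n => n%:R : A) -> (forall n, g.[n.+1%:R] = 0) -> g = 0.
Proof.
move=> injA g0; apply/eqP; apply: contraT => gN0.
have /max_poly_roots := gN0.
move=> /(_ [seq n.+1%:R | n <- iota 0 (size g)]).
rewrite size_map size_iota ltnn; apply.
  by apply/allP => _ /mapP[n _ ->]; rewrite rootE g0.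
by rewrite map_inj_uniq ?iota_uniq // => m n /injA[].
Qed.

Section PolynomialFunctions.
Variable R : realType.
Local Notation C := R[i].

Lemma natC_inj : injective (fun n => n%:R : C).
Proof. by move=> m n /eqP; rewrite eqr_nat => /eqP. Qed.

Lemma natPC_inj : injective (fun n => n%:R : {poly C}).
Proof. by move=> m n; rewrite -!polyC_natr => /polyC_inj/natC_inj. Qed.

(** [f] is [k] with its coefficients reversed; multiplying by ['X^N] clears the negative powers. For
    a form restricted to a line this yields the degree and the leading coefficient. *)
Lemma reverse_poly_coef (f k : {poly C}) D :
  (forall s, s != 0 -> f.[s] = s ^+ D * k.[s^-1]) ->
  (size f <= D.+1)%N /\ f`_D = k.[0].
Proof.
move=> fk; pose N := size k.
have E : f * 'X^N = \sum_(i < N) k`_i *: 'X^(D + N - i).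
  apply/eqP; rewrite -subr_eq0; apply/eqP/(poly_eq0_nat natC_inj) => n.
  have s0 : n.+1%:R != 0 :> C by rewrite pnatr_eq0.
  rewrite hornerD hornerN hornerM hornerXn fk // horner_sum [in k.[_]]horner_coef -/N.
  rewrite mulr_sumr mulr_suml; apply/eqP; rewrite subr_eq0; apply/eqP.
  apply: eq_bigr => i _; rewrite hornerZ hornerXn exprVn.
  have leiD : (i <= D + N)%N by rewrite (leq_trans (ltnW (ltn_ord i))) ?leq_addl.
  rewrite exprB ?unitfE // exprD; set a := (_ ^+ i)^-1; ring.
have fE j : f`_j = \sum_(i < N) k`_i * (j + N == D + N - i)%N%:R.
  have := congr1 (fun p : {poly C} => p`_(j + N)) E.
  rewrite coefMXn ltnNge leq_addl /= addnK => ->.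
  by rewrite coef_sum; apply: eq_bigr => i _; rewrite coefZ coefXn.
split.
  apply/leq_sizeP => j ltDj; rewrite fE big1 // => i _.
  rewrite gtn_eqF ?mulr0 //; apply: leq_ltn_trans (leq_subr _ _) _.
  by rewrite ltn_add2r.
rewrite fE horner_coef0; have [N0|N0] := posnP N.
  rewrite [RHS]nth_default ?big1 //; last by rewrite -/N N0.
  by case=> i lt_i; exfalso; rewrite N0 in lt_i.
rewrite (bigD1 (Ordinal N0)) //= subn0 eqxx mulr1 big1 ?addr0 // => i i0.
rewrite [_ == _]gtn_eqF ?mulr0 // ltn_subrL addn_gt0 N0 orbT andbT lt0n.
by apply: contraNN i0 => /eqP i0; apply/eqP/val_inj.
Qed.

(** Fixing the inner variable u leaves a polynomial in s, the shape that [homotopy_roots_lower]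
    needs: u is the time of the homotopy, s the unknown. *)
Definition poly2_fun (f : C -> C -> C) : Prop :=
  exists F : {poly {poly C}}, forall u s, f u s = (F.[s%:P]).[u].

Lemma poly2_cst c : poly2_fun (fun _ _ => c).
Proof. by exists c%:P%:P => u s; rewrite !hornerC. Qed.

Lemma poly2_fst : poly2_fun (fun u _ => u).
Proof. by exists ('X%:P) => u s; rewrite hornerC hornerX. Qed.

Lemma poly2_snd : poly2_fun (fun _ s => s).
Proof. by exists 'X => u s; rewrite hornerX hornerC. Qed.

Lemma poly2_add f g : poly2_fun f -> poly2_fun g ->
  poly2_fun (fun u s => f u s + g u s).
Proof. by case=> F EF [G EG]; exists (F + G) => u s; rewrite !hornerD EF EG. Qed.

Lemma poly2_mul f g : poly2_fun f -> poly2_fun g ->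
  poly2_fun (fun u s => f u s * g u s).
Proof. by case=> F EF [G EG]; exists (F * G) => u s; rewrite !hornerM EF EG. Qed.

(* Polynomiality of h is only ever used along affine planes, so it is encoded as
   stability of polynomial functions under substitution into h. *)
Definition poly3_fun (h : C -> C -> C -> C) : Prop :=
  forall f1 f2 f3, poly2_fun f1 -> poly2_fun f2 -> poly2_fun f3 ->
  poly2_fun (fun u s => h (f1 u s) (f2 u s) (f3 u s)).

(* The outermost indeterminate is t, the innermost is u. *)
Definition eval3 (G : {poly {poly {poly C}}}) (u s t : C) : C :=
  (G.[t%:P%:P].[s%:P]).[u].

Lemma poly2_ext f g : poly2_fun f -> (forall u s, g u s = f u s) -> poly2_fun g.
Proof. by case=> F EF E; exists F => u s; rewrite E EF. Qed.

Lemma poly3_eval3 G : poly3_fun (eval3 G).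
Proof.
move=> f1 f2 f3 h1 h2 h3; rewrite /eval3.
elim/poly_ind: G => [|G g IH].
  by apply: poly2_ext (poly2_cst 0) _ => u s; rewrite !horner0.
suff hg : poly2_fun (fun u s => (g.[(f2 u s)%:P]).[f1 u s]).
  by apply: poly2_ext (poly2_add (poly2_mul IH h3) hg) _ => u s; rewrite !hornerE.
elim/poly_ind: g {IH} => [|g k IH].
  by apply: poly2_ext (poly2_cst 0) _ => u s; rewrite !horner0.
suff hk : poly2_fun (fun u s => k.[f1 u s]).
  by apply: poly2_ext (poly2_add (poly2_mul IH h2) hk) _ => u s; rewrite !hornerE.
elim/poly_ind: k {IH} => [|k c IH].
  by apply: poly2_ext (poly2_cst 0) _ => u s; rewrite !horner0.
apply: poly2_ext (poly2_add (poly2_mul IH h1) (poly2_cst c)) _ => u s.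
by rewrite !hornerE.
Qed.

End PolynomialFunctions.

(** * Convexity of ternary hyperbolicity cones *)

Section Garding.
Variables (R : realType).
Local Notation C := R[i].
Local Notation ii := (@Complex R 0 1).
Variables (h : C -> C -> C -> C) (D : nat).
Hypothesis hpoly : poly3_fun h.
Hypothesis hhom : forall c u s t, c != 0 -> h (c * u) (c * s) (c * t) = c ^+ D * h u s t.
Hypothesis h001 : h 0 0 1 != 0.
Hypothesis hreal : forall (u s : R) t, h u%:C s%:C t = 0 -> complex.Im t = 0.

Let ii0 : ii != 0.
Proof. by rewrite eq_complex /= oner_eq0 andbF. Qed.

Lemma poly2_affine (a b c : C) : poly2_fun (fun u s => a + u * b + s * c).
Proof.
apply: poly2_add; first apply: poly2_add.
- exact: poly2_cst.
- by apply: poly2_mul; [exact: poly2_fst | exact: poly2_cst].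
- by apply: poly2_mul; [exact: poly2_snd | exact: poly2_cst].
Qed.

(** Let e = (0, 0, 1). As w runs along the segment from ie to v, the polynomials z |-> h(w + z b)
    start with all roots in the lower half-plane, and no root ever becomes real; hence at w = v the
    number i is not a root. *)
Lemma stable_in_cone_direction (b1 b2 b3 : R) (v1 v2 v3 : C) :
  (forall t : R, 0 <= t -> h b1%:C b2%:C (b3 + t)%:C != 0) ->
  (forall s t : R, 0 <= t ->
     h (v1 + s%:C * b1%:C) (v2 + s%:C * b2%:C)
       (v3 + ii * t%:C + s%:C * b3%:C) != 0) ->
  h (v1 + ii * b1%:C) (v2 + ii * b2%:C) (v3 + ii * b3%:C) != 0.
Proof.
move=> hb hv; have hb0 : h b1%:C b2%:C b3%:C != 0.
  by have := hb 0; rewrite addr0 lexx => /(_ isT).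
have [F EF] := hpoly (poly2_affine 0 v1 b1%:C) (poly2_affine 0 v2 b2%:C)
  (poly2_affine ii (v3 - ii) b3%:C).
have fE a z : (map_poly (horner_eval a) F).[z] =
    h (0 + a * v1 + z * b1%:C) (0 + a * v2 + z * b2%:C)
      (ii + a * (v3 - ii) + z * b3%:C).
  rewrite EF -[in LHS](hornerC z a) [LHS](horner_map (horner_eval a)).
  by rewrite /= /horner_eval.
have hz w1 w2 w3 z : z != 0 ->
    h (w1 + z * b1%:C) (w2 + z * b2%:C) (w3 + z * b3%:C) =
    z ^+ D * h (b1%:C + z^-1 * w1) (b2%:C + z^-1 * w2) (b3%:C + z^-1 * w3).
  by move=> z0; rewrite -hhom //; congr h; rewrite mulrDr mulVKf // addrC.
have := @homotopy_roots_lower R F D _ hb0.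
move=> /(_ _ _ _ ii) H; apply/negP => /eqP h0.
suff : complex.Im (ii : C) < 0 by rewrite /= ltr10.
apply: H; last by rewrite rootE fE rmorph1 !mul1r !add0r [_ + (v3 - _)]addrC subrK h0.
- move=> s _.
  (* Reversal in z: h(w + z b) = z^D h(b + w / z), so the leading coefficient is h(b) for every
     w. *)
  have [G EG] := hpoly (poly2_affine b1%:C (0 + s%:C * v1) 0)
    (poly2_affine b2%:C (0 + s%:C * v2) 0)
    (poly2_affine b3%:C (ii + s%:C * (v3 - ii)) 0).
  have [|sD cD] := @reverse_poly_coef R (map_poly (horner_eval s%:C) F) (G.[0%:P]) D.
    by move=> z z0; rewrite fE -EG hz // !mul0r !addr0.
  by split=> //; rewrite cD -EG !mul0r !addr0.
- move=> s x /andP[s0 s1]; rewrite rootE fE.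
  have [->|sN0] := eqVneq s 0.
    rewrite rmorph0 !mul0r !add0r addr0 -!rmorphM; apply/eqP => /hreal /eqP /=.
    by rewrite ?(mulr0, mul0r, addr0, add0r) oner_eq0.
  (* Factor s out: s v + (1 - s) i e + x b = s (v + i ((1 - s) / s) e + (x / s) b). *)
  have := hv (x / s) ((1 - s) / s); rewrite divr_ge0 ?subr_ge0 // => /(_ isT).
  apply: contraNN => /eqP E.
  have sC : s%:C != 0 :> C by rewrite eq_complex /= eqxx andbT.
  suff : s%:C ^+ D * h (v1 + (x / s)%:C * b1%:C) (v2 + (x / s)%:C * b2%:C)
       (v3 + ii * ((1 - s) / s)%:C + (x / s)%:C * b3%:C) = 0.
    by move/eqP; rewrite mulf_eq0 expf_eq0 (negPf sC) andbF.
  by rewrite -hhom // -[RHS]E !rmorphM !fmorphV rmorphB rmorph1 /=; congr h; field.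
(* A root z of h(ie + z b) is nonzero since h(ie) is, and then h(b + (i / z) e) = 0 forces i / z to
   be real and negative. *)
- move=> z; rewrite rootE fE rmorph0 !(mul0r, addr0, add0r) => /eqP E.
  have z0 : z != 0.
    apply: contraTneq h001 => z0; rewrite z0 !mul0r ?addr0 in E.
    have := hhom 0 0 1 ii0; rewrite !mulr0 mulr1 E => /esym/eqP.
    by rewrite mulf_eq0 expf_eq0 (negPf ii0) andbF => /= ->.
  have := hz 0 0 ii z z0; rewrite !add0r E !mulr0 !addr0 => /esym/eqP.
  rewrite mulf_eq0 expf_eq0 (negPf z0) andbF /= => /eqP hE.
  have := hreal hE => Im0.
  pose t := complex.Re (z^-1 * ii).
  have tE : z^-1 * ii = t%:C.
    rewrite [LHS]complexE -/t; move: Im0; case: (z^-1 * ii) => x y /=.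
    by rewrite add0r => ->; rewrite mulr0 addr0.
  have t0 : t < 0.
    rewrite ltNge; apply/negP => /hb; rewrite rmorphD /= -tE => /negP; apply.
    exact/eqP.
  have -> : z = ii * t^-1%:C.
    by rewrite fmorphV /= -tE invfM invrK mulrCA mulfV ?mulr1 // eq_complex /= oner_eq0 andbF.
  by rewrite /= !(mul0r, mulr0, mul1r, add0r, addr0) invr_lt0.
Qed.

(** With a = (1, 0, 0) and b = (0, 1, 0), [stable_in_cone_direction] is used twice: once in a
    direction a + (d / 2) e, then in the direction b + (t / 2) e. The result is that h(i (a + b + t
    e)) is nonzero, and homogeneity removes i. The halves make both directions interior to the
    cone. *)
Lemma garding_convexity :
  (forall t : R, 0 < t -> h 1 0 t%:C != 0) ->
  (forall t : R, 0 < t -> h 0 1 t%:C != 0) ->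
  forall t : R, 0 < t -> h 1 1 t%:C != 0.
Proof.
move=> ha hb t t0.
have stable_a (x1 x2 x3 d : R) : 0 < d ->
    h (x1%:C + ii) x2%:C (x3%:C + ii * d%:C) != 0.
  move=> d0; have d20 : 0 < d / 2 by rewrite divr_gt0.
  have := @stable_in_cone_direction 1 0 (d / 2)
    x1%:C x2%:C (x3%:C + ii * (d / 2)%:C).
  rewrite rmorph1 rmorph0 !mulr1 !mulr0 addr0 -addrA -mulrDr -rmorphD -splitr.
  apply=> [s s0|s s1 s0]; first by rewrite ha // ltr_wpDr.
  rewrite -rmorphM -rmorphD mulr0 addr0; apply/eqP => /hreal /eqP /=.
  by rewrite !(mul0r, mulr0, mul1r, add0r, addr0) gt_eqF // ltr_wpDr.
have d0 : 0 < t / 2 by rewrite divr_gt0.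
have := @stable_in_cone_direction 0 1 (t / 2) ii 0 (ii * (t / 2)%:C).
rewrite rmorph1 rmorph0 mulr1 mulr0 addr0 add0r -mulrDr -rmorphD -splitr.
rewrite -[X in h X _ _]mulr1 -[X in h _ X _]mulr1 hhom // mulf_eq0 negb_or.
case/(_ _ _)/andP => // [s s0|s s1 s0]; first by rewrite hb // ltr_wpDr.
rewrite mulr0 addr0 mulr1 add0r -mulrDr -rmorphD -rmorphM [X in h _ _ X]addrC.
have := stable_a 0 s (s * (t / 2)) (t / 2 + s1).
by rewrite rmorph0 add0r; apply; rewrite ltr_wpDr.
Qed.

End Garding.

(** * Complex values of p on planes *)

Section ComplexValues.
Variables (R : realType) (n d : nat) (p : mpoly n R).
Local Notation C := R[i].
Implicit Types (x y z e : 'rV[R]_n).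

Definition pval (w : 'I_n -> C) : C := mmap (real_complex R) w p.

Lemma eq_pval w1 w2 : w1 =1 w2 -> pval w1 = pval w2.
Proof. by move=> /funext ->. Qed.

Lemma pval_real x : pval (fun i => (x 0 i)%:C) = (evalp p x)%:C.
Proof.
rewrite /pval /evalp mevalE /mmap rmorph_sum /=; apply: eq_bigr => k _.
rewrite rmorphM /mmap1 rmorph_prod /=; congr (_ * _).
by apply: eq_bigr => i _; rewrite rmorphXn.
Qed.

Lemma pval_homogeneous (homp : homogeneous d p) (c : C) w :
  pval (fun i => c * w i) = c ^+ d * pval w.
Proof.
rewrite /pval /mmap mulr_sumr [LHS]big_seq [RHS]big_seq.
apply: eq_bigr => k kp; have <- : mdeg k = d by move/dhomogP: homp => /(_ k kp).
rewrite mulrCA; congr (_ * _); rewrite /mmap1 mdegE expr_sum -big_split /=.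
by apply: eq_bigr => i _; rewrite exprMn.
Qed.

Lemma pval_line_poly e x (t : C) :
  (map_poly (real_complex R) (line_poly p e x)).[t] =
  pval (fun i => t * (e 0 i)%:C - (x 0 i)%:C).
Proof.
rewrite /line_poly /pval /mmap rmorph_sum horner_sum; apply: eq_bigr => k _.
rewrite rmorphM hornerM /= map_polyC hornerC; congr (_ * _).
rewrite /mmap1 rmorph_prod horner_prod; apply: eq_bigr => i _.
rewrite rmorphXn horner_exp rmorphB /= map_polyZ map_polyX map_polyC.
by rewrite !hornerE mulrC.
Qed.

Definition plane_poly x z e : {poly {poly {poly C}}} :=
  mmap (fun c : R => c%:C%:P%:P%:P)
    (fun i => (x 0 i)%:C%:P%:P%:P * 'X%:P%:P + (z 0 i)%:C%:P%:P%:P * 'X%:P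
              + (e 0 i)%:C%:P%:P%:P * 'X) p.

Lemma eval3_plane_poly x z e u s t :
  eval3 (plane_poly x z e) u s t =
  pval (fun i => u * (x 0 i)%:C + s * (z 0 i)%:C + t * (e 0 i)%:C).
Proof.
rewrite /eval3 /plane_poly /pval /mmap !horner_sum; apply: eq_bigr => k _.
rewrite !hornerM !hornerC; congr (_ * _).
rewrite /mmap1 !horner_prod; apply: eq_bigr => i _.
rewrite !horner_exp; congr (_ ^+ _).
by rewrite !(hornerD, hornerM, hornerC, hornerX) [u * _]mulrC [s * _]mulrC [t * _]mulrC.
Qed.

Lemma eval3_horner (G : {poly {poly {poly C}}}) u s t :
  eval3 G u s t = (map_poly (horner_eval u \o horner_eval s%:P) G).[t].
Proof.
rewrite /eval3 -[G.[_].[_].[_]]/((horner_eval u \o horner_eval s%:P) G.[t%:P%:P]).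
by rewrite -horner_map /= /horner_eval !hornerC.
Qed.

(* The coefficient of t ^ k in p (y + t e): line_poly subtracts its last
   argument, hence the sign. *)
Definition dir_coef e k y : R := (line_poly p e (- y))`_k.

(** Equality at all positive integers t gives equality of coefficients. Vanishing of [dir_coef] on
    integer combinations thus becomes vanishing of a polynomial in u and s. *)
Lemma coef_plane_poly x z e (u s : R) k :
  ((plane_poly x z e)`_k).[s%:C%:P].[u%:C] = (dir_coef e k (u *: x + s *: z))%:C.
Proof.
suff E : map_poly (horner_eval u%:C \o horner_eval s%:C%:P) (plane_poly x z e) =
    map_poly (real_complex R) (line_poly p e (- (u *: x + s *: z))).
  by have := congr1 (fun q : {poly C} => q`_k) E; rewrite !coef_map.
apply/eqP; rewrite -subr_eq0; apply/eqP/(poly_eq0_nat (@natC_inj R)) => j.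
rewrite hornerD hornerN -eval3_horner eval3_plane_poly pval_line_poly.
apply/eqP; rewrite subr_eq0; apply/eqP/eq_pval => i.
by rewrite !mxE rmorphN opprK rmorphD !rmorphM addrC.
Qed.

End ComplexValues.

(** * Hyperbolicity on planes and convexity of the cone *)

Section HyperbolicPlane.
Variables (R : realType) (n d : nat) (p : mpoly n R) (e : 'rV[R]_n).
Local Notation C := R[i].
Hypotheses (homp : homogeneous d p) (hypp : hyperbolic p e).
Implicit Types (x y z : 'rV[R]_n).

Lemma plane_homogeneous x z (c u s t : C) :
  eval3 (plane_poly p x z e) (c * u) (c * s) (c * t) =
  c ^+ d * eval3 (plane_poly p x z e) u s t.
Proof.
rewrite !eval3_plane_poly -(pval_homogeneous homp); apply: eq_pval => i.
by ring.
Qed.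

Lemma plane_real x z (u s : R) (t : C) :
  eval3 (plane_poly p x z e) u%:C s%:C t = 0 -> complex.Im t = 0.
Proof.
rewrite eval3_plane_poly => E.
have [_ /(_ (- (u *: x + s *: z)) t)] := hypp.
have lz : line_zero p e (- (u *: x + s *: z)) t.
  apply/eqP; rewrite pval_line_poly -[RHS]E; apply: eq_pval => i.
  by rewrite !mxE rmorphN opprK rmorphD !rmorphM addrC.
by move=> /(_ lz)/RIm_real [].
Qed.

Lemma eval3_plane_real x z (u s t : R) :
  eval3 (plane_poly p x z e) u%:C s%:C t%:C = (evalp p (u *: x + s *: z + t *: e))%:C.
Proof.
rewrite eval3_plane_poly -pval_real; apply: eq_pval => i.
by rewrite !mxE !rmorphD !rmorphM.
Qed.

(** By homogeneity p(te - y) = (-1)^d p(y - te), and all zeros are real, so only negative real t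
    have to be excluded. *)
Lemma hyperbolicity_coneP y :
  hyperbolicity_cone p e y <-> forall t, 0 < t -> evalp p (y + t *: e) != 0.
Proof.
have zeroE (t : R) : line_zero p e y t%:C <-> evalp p (y - t *: e) = 0.
  rewrite /line_zero rootE pval_line_poly.
  have -> : pval p (fun i => t%:C * (e 0 i)%:C - (y 0 i)%:C) =
      (-1) ^+ d * (evalp p (y - t *: e))%:C.
    rewrite -pval_real -(pval_homogeneous homp); apply: eq_pval => i.
    by rewrite !mxE rmorphB rmorphM mulN1r opprB.
  rewrite mulf_eq0 expf_eq0 oppr_eq0 oner_eq0 andbF /=.
  split=> [/eqP/complexI//|->]; exact: eqxx.
split=> [ye t t0|hy z yz].
  apply/eqP => E; have /ye : line_zero p e y (- t)%:C.
    by apply/zeroE; rewrite scaleNr opprK.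
  by rewrite ler0c oppr_ge0 leNgt t0.
have /complex_realP[t zt] := (proj2 hypp) y z yz; rewrite zt ler0c leNgt.
rewrite zt in yz; apply/negP => t0.
have := hy (- t); rewrite oppr_gt0 => /(_ t0).
by rewrite scaleNr (proj1 (zeroE t) yz) eqxx.
Qed.

Lemma hyperbolicity_cone_add x y :
  hyperbolicity_cone p e x -> hyperbolicity_cone p e y ->
  hyperbolicity_cone p e (x + y).
Proof.
move=> /hyperbolicity_coneP hx /hyperbolicity_coneP hy.
apply/hyperbolicity_coneP => t t0.
have c1 : (1 : R)%:C = 1 :> C by [].
have c0 : (0 : R)%:C = 0 :> C by [].
have : eval3 (plane_poly p x y e) 1 1 t%:C != 0; last first.
  by rewrite -c1 eval3_plane_real !scale1r; apply: contraNN => /eqP ->.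
apply: (@garding_convexity R _ d (@poly3_eval3 R _)
  (fun c u s t _ => plane_homogeneous x y c u s t) _ (@plane_real x y)) => //;
  rewrite -?c1 -c0.
- rewrite eval3_plane_real !scale0r scale1r !add0r.
  by rewrite eq_complex /= eqxx andbT gt_eqF // (proj1 hypp).
- move=> s s0; rewrite eval3_plane_real scale0r scale1r addr0.
  by rewrite eq_complex /= eqxx andbT hx.
- move=> s s0; rewrite eval3_plane_real scale0r scale1r add0r.
  by rewrite eq_complex /= eqxx andbT hy.
Qed.

(** For fixed i and j the coefficient is a polynomial in the multiple of z; it vanishes at all
    positive integers, hence also at -i. *)
Lemma dir_coef_eq0_sub k x z w :
  (forall i j l : nat, dir_coef p e k (i%:R *: x + j%:R *: z + l%:R *: w) = 0) ->
  forall i j : nat, dir_coef p e k (i%:R *: (x - z) + j%:R *: w) = 0.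
Proof.
move=> h i j; pose v := i%:R *: x + j%:R *: w.
have g0 : ((plane_poly p z v e)`_k).[1%:P] = 0.
  apply: (poly_eq0_nat (@natC_inj R)) => l.
  have := coef_plane_poly p z v e l.+1%:R 1 k.
  rewrite rmorph1 rmorph_nat => ->; rewrite scale1r addrC.
  by rewrite /v addrAC h.
have := coef_plane_poly p z v e (- i%:R) 1 k; rewrite rmorph1 g0 horner0.
rewrite scale1r => /esym/complexI <-; congr dir_coef.
by rewrite /v scalerBr scaleNr addrA [_ + i%:R *: x]addrC.
Qed.

(** The reversal p(z + s e) = s^d p(e + z / s) exchanges the roles of e and z. *)
Lemma size_line_poly z : (size (line_poly p e (- z)) <= d.+1)%N.
Proof.
rewrite -(size_map_poly (real_complex R)).
have [|//] := @reverse_poly_coef R (map_poly (real_complex R) (line_poly p e (- z)))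
  (map_poly (real_complex R) (line_poly p z (- e))) d.
move=> s s0; rewrite !pval_line_poly -(pval_homogeneous homp); apply: eq_pval => i.
by rewrite !mxE !rmorphN !opprK mulrDr mulVKf // addrC.
Qed.

End HyperbolicPlane.

(** * Directions spanned by a face *)

Lemma poly_neq0_left (R : realFieldType) (g : {poly R}) : g != 0 ->
  exists2 mu : R, 0 < mu & forall t, 0 < t -> t < mu -> g.[- t] != 0.
Proof.
have [k] := ubnP (size g); elim: k g => // k IH g ltk g0.
have [[t t0 gt]|nroot] := pselect (exists2 t, 0 < t & g.[- t] = 0); last first.
  by exists 1 => // t t0 _; apply/eqP => gt; apply: nroot; exists t.
have /factor_theorem[q gq] : root g (- t) by apply/eqP.
have q0 : q != 0 by apply: contraNneq g0 => q0; rewrite gq q0 mul0r.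
have [|mu mu0 hmu] := IH q _ q0.
  by move: ltk; rewrite gq size_Mmonic ?monicXsubC // size_XsubC addn2 /= ltnS.
exists (Num.min mu t); first by rewrite lt_min mu0.
move=> s s0; rewrite lt_min => /andP[smu st].
rewrite gq hornerM mulf_neq0 ?hmu // hornerXsubC opprK addrC subr_eq0.
by rewrite gt_eqF.
Qed.

Section FaceDirections.
Variables (R : realType) (n d : nat) (p : mpoly n R) (e : 'rV[R]_n).
Local Notation C := R[i].
Hypotheses (homp : homogeneous d p) (hypp : hyperbolic p e).
Implicit Types (x y z : 'rV[R]_n).

Lemma evalp_scale (c : R) x : evalp p (c *: x) = c ^+ d * evalp p x.
Proof.
apply: (@complexI R); rewrite rmorphM rmorphXn /= -!pval_real -(pval_homogeneous homp).
apply: eq_pval => i.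
by rewrite mxE rmorphM.
Qed.

(** If m > 0, then z - mu e is not in the cone of p, since p(z - mu e + t e) vanishes at t = mu.
    Dividing the plane polynomial by t^m removes this zero, and Garding's theorem is applied to the
    quotient. *)
Lemma cone_add_scaled x z m (mu : R) : 0 < mu ->
  (forall k, (k < m)%N -> forall i j : nat,
     dir_coef p e k (i%:R *: x + j%:R *: z) = 0) ->
  dir_coef p e m z != 0 ->
  (forall t, 0 < t -> t < mu -> evalp p (z - t *: e) != 0) ->
  hyperbolicity_cone p e (x + e) -> hyperbolicity_cone p e z ->
  hyperbolicity_cone p e (mu *: x + z).
Proof.
move=> mu0 low zm zmu /(hyperbolicity_coneP homp hypp) hx.
move=> /(hyperbolicity_coneP homp hypp) hz.
pose P := plane_poly p x z e; pose G := drop_poly m P.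
have PG : P = G * 'X^m.
  rewrite -[LHS](poly_take_drop m) -/G [take_poly m P](_ : _ = 0) ?add0r //.
  apply/polyP => k; rewrite coef_take_poly coef0; case: ltnP => // ltkm.
  (* Polynomial continuation from positive integers, first in s, then in u. *)
  apply: (poly_eq0_nat (@natPC_inj R)) => j.
  apply: (poly_eq0_nat (@natC_inj R)) => i.
  have := coef_plane_poly p x z e i.+1%:R j.+1%:R k.
  by rewrite !rmorph_nat low.
have PGE u s t : eval3 P u s t = eval3 G u s t * t ^+ m.
  by rewrite PG /eval3 !hornerM !hornerXn -!rmorphXn !hornerC.
(* The degree [d - m] of the quotient is a truncated difference, hence this bound. *)
have lemd : (m <= d)%N.
  rewrite leqNgt; apply: contra zm => ltdm; rewrite /dir_coef nth_default //.
  by apply: leq_trans (@size_line_poly R n d p e homp z) _.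
have G010 : eval3 G 0 1 0 != 0.
  rewrite /eval3 !polyC0 [G.[0]]horner_coef0 coef_drop_poly add0n.
  have := coef_plane_poly p x z e 0 1 m; rewrite rmorph1 rmorph0 => ->.
  by rewrite scale0r scale1r add0r eq_complex /= eqxx andbT.
have Ghom (c u s t : C) : c != 0 ->
    eval3 G (c * u) (c * s) (c * t) = c ^+ (d - m) * eval3 G u s t.
  move=> c0; rewrite !eval3_horner.
  set g1 := map_poly _ G; set g2 := map_poly _ G.
  (* At t = 0 the factor t^m cannot be cancelled, so both sides are compared as polynomials in t, at
     positive integers. *)
  suff E : g1 \Po (c *: 'X) = c ^+ (d - m) *: g2.
    have := congr1 (fun q : {poly C} => q.[t]) E.
    by rewrite /= horner_comp !hornerE.
  apply/eqP; rewrite -subr_eq0; apply/eqP/(poly_eq0_nat (@natC_inj R)) => j.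
  have j0 : j.+1%:R != 0 :> C by rewrite pnatr_eq0.
  rewrite hornerD hornerN horner_comp !hornerZ hornerX -!eval3_horner.
  apply/eqP; rewrite subr_eq0; apply/eqP.
  have cj0 : (c * j.+1%:R) ^+ m != 0 by rewrite expf_neq0 // mulf_neq0.
  apply: (mulIf cj0); rewrite -PGE (plane_homogeneous e homp) PGE.
  by rewrite exprMn -{1}(subnK lemd) exprD; ring.
(* Coordinates along mu (x + e), z - mu e and e; the first two directions sum to mu x + z. *)
pose h u s t := eval3 G (mu%:C * u) s (t + mu%:C * u - mu%:C * s).
apply/(hyperbolicity_coneP homp hypp) => t t0.
have Preal (u s r : R) : eval3 P u%:C s%:C r%:C != 0 ->
    eval3 G u%:C s%:C r%:C != 0.
  by apply: contraNN => /eqP E; rewrite PGE E mul0r.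
have c1 : (1 : R)%:C = 1 :> C by [].
have c0 : (0 : R)%:C = 0 :> C by [].
have : h 1 1 t%:C != 0; last first.
  rewrite /h mulr1 addrK -c1 => hN0.
  have : eval3 P mu%:C 1%:C t%:C != 0.
    rewrite PGE mulf_neq0 // expf_neq0 // eq_complex /= eqxx andbT gt_eqF //.
  by rewrite eval3_plane_real scale1r; apply: contraNN => /eqP ->.
apply: (@garding_convexity R h (d - m)) => // {t t0}.
- move=> f1 f2 f3 h1 h2 h3; apply: poly3_eval3.
  + exact: poly2_mul (poly2_cst _) h1.
  + exact: h2.
  + apply: poly2_ext (poly2_add (poly2_add h3 (poly2_mul (poly2_cst mu%:C) h1))
      (poly2_mul (poly2_cst (- mu%:C)) h2)) _ => u s.
    by rewrite mulNr.
- by move=> c u s t cN0; rewrite -Ghom // /h; congr eval3; ring.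
- rewrite /h !mulr0 subr0 addr0 -c0 -c1; apply: Preal; rewrite eval3_plane_real.
  by rewrite !scale0r scale1r !add0r eq_complex /= eqxx andbT gt_eqF // (proj1 hypp).
- move=> u s t; have [T0|TN0] := eqVneq (t + mu%:C * u%:C - mu%:C * s%:C) 0.
    move=> _; have -> : t = (mu * s - mu * u)%:C.
      by rewrite rmorphB !rmorphM; apply/eqP; rewrite -subr_eq0 -T0; apply/eqP; ring.
    by [].
  move=> hE; have : eval3 P (mu * u)%:C s%:C (t + mu%:C * u%:C - mu%:C * s%:C) = 0.
    by rewrite PGE rmorphM; move: hE; rewrite /h => ->; rewrite mul0r.
  move/(plane_real hypp); rewrite -!rmorphM.
  by case: t {hE TN0} => a b /=; rewrite !(oppr0, addr0).
- move=> t t0; rewrite /h mulr1 mulr0 subr0 -rmorphD -c0; apply: Preal.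
  rewrite eval3_plane_real scale0r addr0.
  have -> : mu *: x + (t + mu) *: e = mu *: (x + e + (t / mu) *: e).
    by rewrite !scalerDr scalerA mulrCA mulfV ?gt_eqF // mulr1 scalerDl -addrA [mu *: e + _]addrC.
  rewrite evalp_scale // eq_complex /= eqxx andbT mulf_neq0 //.
    by rewrite expf_neq0 // gt_eqF.
  by rewrite hx // divr_gt0.
- move=> t t0; rewrite /h mulr1 mulr0 addr0 -rmorphB -c1 -c0.
  (* At t = mu the value is that of [G010]; below mu the eigenvalue gap [zmu] applies, above it the
     membership of z in the cone. *)
  have [->|tmu] := eqVneq t mu; first by rewrite subrr.
  apply: Preal; rewrite eval3_plane_real scale0r scale1r add0r.
  rewrite eq_complex /= eqxx andbT; case: (ltgtP t mu) tmu => // lt _.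
    have -> : t - mu = - (mu - t) by rewrite opprB.
    by rewrite scaleNr zmu ?subr_gt0 // ltrBlDr ltrDl.
  by rewrite hz // subr_gt0.
Qed.

End FaceDirections.

(** * Norms *)

Section NormEquivalence.
Variables (R : realType) (n : nat) (N : 'rV[R]_n -> R).
Hypothesis normN : is_norm N.
Implicit Types x y : 'rV[R]_n.

Lemma is_norm0 : N 0 = 0.
Proof. by case: normN => _ _ NZ _; rewrite -(scale0r 0) NZ normr0 mul0r. Qed.

Lemma is_normN x : N (- x) = N x.
Proof. by case: normN => _ _ NZ _; rewrite -scaleN1r NZ normrN1 mul1r. Qed.

Lemma is_norm_le_mx_norm : exists2 M : R, 0 <= M & forall x, N x <= M * `|x|.
Proof.
have [N0 _ NZ ND] := normN.
exists (\sum_i N (delta_mx 0 i)); first exact: sumr_ge0.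
move=> x; rewrite {1}(row_sum_delta x) mulr_suml.
apply: (@le_trans _ _ (\sum_i N (x 0 i *: delta_mx 0 i))).
  apply: (big_ind2 (fun v r => N v <= r)); rewrite ?is_norm0 // => v1 r1 v2 r2 h1 h2.
  by apply: le_trans (ND _ _) _; exact: lerD.
apply: ler_sum => i _; rewrite NZ mulrC ler_wpM2l //.
by rewrite [`|x|]/Num.norm /= mx_normrE; apply/bigmax_geP; right => /=; exists (0, i).
Qed.

Lemma is_norm_continuous : continuous N.
Proof.
have [N0 _ NZ ND] := normN; have [M M0 hM] := is_norm_le_mx_norm.
have dN x y : `|N x - N y| <= M * `|x - y|.
  apply: le_trans (hM _); rewrite ler_norml lerBrDl lerBlDl.
  have := ND (x - y) y; have := ND (y - x) x.
  rewrite !subrK -(opprB x y) is_normN; lra.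
move=> x; apply/(@cvgrPdist_le _ _ _ _ (nbhs_filter x)) => eps eps0; apply/(@nbhs_normP R 'rV[R]_n).
exists (eps / (M + 1)) => [|y /ltW] /=; first by rewrite divr_gt0 // ltr_wpDl.
rewrite ler_pdivlMr ?ltr_wpDl // => le_eps.
apply: le_trans (dN x y) (le_trans _ le_eps).
by rewrite mulrC ler_wpM2l // lerDl.
Qed.

(** [N] attains a positive minimum on the compact unit sphere of the sup norm; its inverse is the
    constant. *)
Lemma mx_norm_le_is_norm : exists2 c : R, 0 < c & forall x, `|x| <= c * N x.
Proof.
have [N0 N1 NZ ND] := normN.
pose S := [set x : 'rV[R]_n | `|x| = 1].
(* An empty sphere means dimension 0, where every vector is 0. *)
have [S0|/set0P/negP] := pselect (S !=set0); last first.
  rewrite negbK => /eqP S0; exists 1 => // x.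
  have [->|x0] := eqVneq x 0; first by rewrite normr0 mul1r N0.
  suff : S (`|x|^-1 *: x) by rewrite S0.
  by rewrite /S /= normrZ normfV normr_id mulVf ?normr_eq0.
have cS : compact S.
  apply: bounded_closed_compact.
    by exists 1; split => // M M1 x /= ->; exact: ltW.
  apply: (@closed_comp _ _ (fun x : 'rV[R]_n => `|x|) [set 1]).
    by move=> x _; exact: norm_continuous.
  exact: closed_eq.
have [|v vS vmin] := @EVT_min_rV R n N S S0 cS.
  exact: continuous_subspaceT is_norm_continuous.
have v1 : `|v| = 1 by move: vS; rewrite inE.
have Nv : 0 < N v.
  rewrite lt_def N0 andbT; apply: contra_eq_neq v1 => /N1 ->.
  by rewrite normr0 eq_sym oner_eq0.
exists (N v)^-1 => [|x]; first by rewrite invr_gt0.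
have [->|x0] := eqVneq x 0; first by rewrite normr0 is_norm0 mulr0.
have x0' : 0 < `|x| by rewrite normr_gt0.
rewrite mulrC ler_pdivlMr // mulrC -ler_pdivlMr //.
have := vmin (`|x|^-1 *: x); rewrite NZ normfV normr_id [leRHS]mulrC; apply.
by rewrite inE /S /= normrZ normfV normr_id mulVf ?normr_eq0.
Qed.

End NormEquivalence.

Lemma continuous_evalp (R : realType) (n : nat) (p : mpoly n R) :
  continuous (evalp p).
Proof.
rewrite (_ : evalp p = fun x => \sum_(m <- msupp p) mcoeff m p * \prod_i x 0 i ^+ m i).
  apply: continuous_big => [|m _]; first exact: (@add_continuous R^o).
  move=> x; have FF := nbhs_filter x.
  apply: (@cvgM R _ (nbhs x) FF (fun=> mcoeff m p)); first exact: cvg_cst.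
  apply: (@cvg_big R _ *%R 1 xpredT (@mul_continuous R) _ (nbhs x) _
    (fun i (y : 'rV[R]_n) => y 0 i ^+ m i)) => i _.
  apply: (@continuous_comp _ _ _ (fun y : 'rV[R]_n => y 0 i)
    (fun r : R => r ^+ m i) x); first exact: coord_continuous.
  exact: exprn_continuous.
by apply/funext => x; rewrite /evalp mevalE.
Qed.

(** * Faces and distances *)

Section Amenability.
Variables (R : realType) (n d : nat) (N : 'rV[R]_n -> R).
Variables (p : mpoly n R) (e : 'rV[R]_n).
Hypotheses (normN : is_norm N).
Hypotheses (homp : homogeneous d p) (hypp : hyperbolic p e).
Implicit Types (x y z w : 'rV[R]_n).
Local Notation K := (hyperbolicity_cone p e).

Lemma cone_scale (c : R) y : 0 < c -> K y -> K (c *: y).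
Proof.
move=> c0 /(hyperbolicity_coneP homp hypp) hy.
apply/(hyperbolicity_coneP homp hypp) => t t0.
have -> : c *: y + t *: e = c *: (y + (t / c) *: e).
  by rewrite scalerDr scalerA mulrCA mulfV ?gt_eqF // mulr1.
by rewrite (evalp_scale homp) mulf_neq0 ?hy ?divr_gt0 // expf_neq0 // gt_eqF.
Qed.

Lemma cone0 : K 0.
Proof.
apply/(hyperbolicity_coneP homp hypp) => t t0; rewrite add0r (evalp_scale homp).
by rewrite mulf_neq0 ?expf_neq0 ?gt_eqF // (proj1 hypp).
Qed.

(** p is positive on a ball around e, and for c, t > 0 the vector w + (c + t) e is c + t times a
    point of that ball. *)
Lemma cone_interior : exists2 r : R, 0 < r &
  forall w c, 0 <= c -> N w <= r * c -> K (w + c *: e).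
Proof.
have [N0 N1 NZ ND] := normN; have [M M0 hM] := mx_norm_le_is_norm normN.
have : \forall y \near e, 0 < evalp p y.
  apply: (@cvgr_gt _ _ _ (nbhs_filter e) _ _ (@continuous_evalp R n p e)).
  exact: (proj1 hypp).
move=> /(@nbhs_normP R 'rV[R]_n)[rho rho0 hrho].
exists (rho / (2 * M)) => [|w c]; first by rewrite divr_gt0 // mulr_gt0.
rewrite le_eqVlt => /predU1P[<-|c0].
  rewrite mulr0 => w0; have /N1 -> : N w = 0 by apply/le_anti; rewrite w0 N0.
  by rewrite scale0r addr0; exact: cone0.
move=> Nw; apply/(hyperbolicity_coneP homp hypp) => t t0.
have ct0 : 0 < c + t by rewrite addr_gt0.
have -> : w + c *: e + t *: e = (c + t) *: (e + (c + t)^-1 *: w).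
  by rewrite scalerDr scalerA mulfV ?gt_eqF // scale1r scalerDl
       -[LHS]addrA [LHS]addrC.
rewrite (evalp_scale homp) mulf_neq0 ?expf_neq0 ?(gt_eqF ct0) //.
rewrite gt_eqF //; apply: hrho => /=.
rewrite opprD addNKr normrN normrZ gtr0_norm ?invr_gt0 // mulrC ltr_pdivrMr //.
apply: le_lt_trans (hM w) _.
have le1 : M * N w <= rho / 2 * c.
  have -> : rho / 2 * c = M * (rho / (2 * M) * c) by field; rewrite gt_eqF.
  by rewrite ler_wpM2l // ltW.
apply: le_lt_trans le1 _; rewrite -mulrA ltr_pM2l //; lra.
Qed.

(** * Faces of the hyperbolicity cone and the error bound *)

Section Face.
Variable F : set 'rV[R]_n.
Hypotheses (faceF : face K F) (F_neq0 : F !=set0).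

Lemma face_conv x y (c : R) : 0 <= c -> c <= 1 -> F x -> F y ->
  F (c *: x + (1 - c) *: y).
Proof.
case: faceF => _ cvF _ _ c0 c1 Fx Fy.
by have := cvF x y (Itv01 c0 c1); rewrite !inE => /(_ Fx Fy).
Qed.

(** A point y of the face is the midpoint of 2y and 0, both in the cone. *)
Lemma face0 : F 0.
Proof.
case: faceF => _ _ FK Fext; case: F_neq0 => y Fy.
have half : 0 < 2^-1 :> R /\ 2^-1 < 1 :> R by lra.
have := Fext (2 *: y) 0 2^-1 (cone_scale _ (FK _ Fy)) cone0 half.1 half.2.
rewrite scaler0 addr0 scalerA mulVf // scale1r => /(_ _ Fy) [] //.
Qed.

(** For c > 1, y lies between c y and 0, so facial exposure gives c y; for c <= 1, convexity with 0
    suffices. *)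
Lemma face_scale (c : R) y : 0 <= c -> F y -> F (c *: y).
Proof.
case: faceF => _ _ FK Fext c0 Fy.
have [c1|c1] := leP c 1.
  by have := face_conv c0 c1 Fy face0; rewrite scaler0 addr0.
have c_gt0 : 0 < c by rewrite (lt_trans _ c1).
have := Fext (c *: y) 0 c^-1 (cone_scale c_gt0 (FK _ Fy)) cone0.
rewrite scaler0 addr0 scalerA mulVf ?gt_eqF // scale1r invr_gt0 invf_lt1 //.
by move=> /(_ c_gt0 c1 Fy) [].
Qed.

Lemma face_add x y : F x -> F y -> F (x + y).
Proof.
move=> Fx Fy.
have half : 0 <= 2^-1 :> R /\ 2^-1 <= 1 :> R by lra.
have := face_scale (ler0n _ 2) (face_conv half.1 half.2 Fx Fy).
have -> : 1 - 2^-1 = 2^-1 :> R by lra.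
by rewrite -scalerDr scalerA mulfV // scale1r.
Qed.

(** x / 2 is the midpoint of x - y and y. Hence the cone meets F - F only in F. *)
Lemma face_sub x y : F x -> F y -> K (x - y) -> F (x - y).
Proof.
case: faceF => _ _ FK Fext Fx Fy Kxy.
have half : 0 < 2^-1 :> R /\ 2^-1 < 1 :> R by lra.
have := Fext (x - y) y 2^-1 Kxy (FK _ Fy) half.1 half.2.
have -> : 1 - 2^-1 = 2^-1 :> R by lra.
rewrite -scalerDr subrK => /(_ (face_scale _ Fx)) [] //.
Qed.

Lemma face_span x : set_span F x -> exists y z, [/\ F y, F z & x = y - z].
Proof.
case=> s sF /(coord_span (X := in_tuple s)) ->.
elim/big_ind : _ => [|u v [y1 [z1 [Fy1 Fz1 ->]]] [y2 [z2 [Fy2 Fz2 ->]]]|i _].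
- by exists 0, 0; rewrite subr0; split=> //; exact: face0.
- exists (y1 + y2), (z1 + z2); split; [exact: face_add|exact: face_add|].
  by rewrite opprD addrACA.
have Fi : F (in_tuple s)`_i by apply/sF/mem_nth; rewrite ltn_ord.
set c := coord _ _ _; have [c0|c0] := leP 0 c.
  by exists (c *: (in_tuple s)`_i), 0; rewrite subr0; split=> //; [exact: face_scale|exact: face0].
exists 0, (- c *: (in_tuple s)`_i); split; [exact: face0| |].
  by apply: face_scale => //; rewrite oppr_ge0 ltW.
by rewrite sub0r scaleNr opprK.
Qed.

(** The multiplicity of the eigenvalue 0 of y is the order of vanishing of p(y + t e) at t = 0; its
    minimum over F is attained at z. *)
Lemma face_min_multiplicity : exists m z, [/\ F z, dir_coef p e m z != 0 &
  forall k y, (k < m)%N -> F y -> dir_coef p e k y = 0].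
Proof.
pose P k := `[< exists2 y, F y & dir_coef p e k y != 0 >].
have exP : exists k, P k.
  (* For y = 0 the polynomial takes the value p(e) at t = 1, so it is nonzero and its leading
     coefficient is a witness. *)
  exists (size (line_poly p e (- 0))).-1; apply/asboolP; exists 0; first exact: face0.
  rewrite /dir_coef -lead_coefE lead_coef_eq0; apply: contraTneq (proj1 hypp) => h0.
  by have := line_polyE p e (- 0) 1; rewrite h0 horner0 scale1r oppr0 subr0 => <-; rewrite ltxx.
case: (ex_minnP exP) => m /asboolP[z Fz zm] minm.
exists m, z; split=> // k y ltkm Fy; apply/eqP; apply: contraLR ltkm => ky.
by rewrite -leqNgt minm //; apply/asboolP; exists y.
Qed.

Lemma dist_le x y C : C y -> dist N x C <= N (x - y).
Proof.
case: normN => N0 _ _ _ Cy; apply: ge_inf; last by exists y.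
by exists 0 => _ [z _ <-].
Qed.

Lemma face_error_bound : exists2 kappa : R, 0 < kappa &
  forall x, set_span F x -> dist N x F <= kappa * dist N x K.
Proof.
have [N0 N1 NZ ND] := normN.
have [m [z [Fz zm low]]] := face_min_multiplicity.
have [|mu mu0 zmu] := @poly_neq0_left R (line_poly p e (- z)).
  by apply: contraNneq zm => h0; rewrite /dir_coef h0 coef0.
have [r r0 hr] := cone_interior.
have FK : F `<=` K by case: faceF.
(* The first summand comes from the distance (c / mu) N(z) reached at the end; adding 1 keeps
   [kappa] positive even when z = 0. *)
pose kappa := N z / (mu * r) + 1.
have kappa0 : 0 < kappa by rewrite ltr_wpDl // divr_ge0 // mulr_ge0 ?ltW.
exists kappa => // x /face_span[a [b [Fa Fb xE]]].
rewrite -ler_pdivrMl //; apply: lb_le_inf.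
  by exists (N (x - 0)); exists 0 => //; exact: cone0.
move=> _ [y Ky <-]; rewrite ler_pdivrMl //.
pose c := N (x - y) / r.
have c0 : 0 <= c by rewrite divr_ge0 // ltW.
have Kxc : K (x + c *: e).
  have := hr (x - y) c c0; rewrite mulrCA mulfV ?gt_eqF // mulr1 lexx => /(_ isT).
  by move=> /(hyperbolicity_cone_add homp hypp Ky); rewrite addrA [y + _]addrC subrK.
(* If c = 0, then x is itself in the cone and [face_sub] puts it in F; otherwise division by c
   normalizes the shift to e. *)
move: c0; rewrite le_eqVlt => /predU1P[c0|c0].
  have Fx : F x.
    by rewrite xE; apply: face_sub => //; rewrite -xE -[x]addr0 -(scale0r e) [0]c0.
  by apply: le_trans (dist_le x Fx) _; rewrite subrr is_norm0 // mulr_ge0 // ltW.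
have Kx : K (mu *: (c^-1 *: x) + z).
  apply: (cone_add_scaled homp hypp mu0 (m := m)) => //.
  - move=> k ltkm i j; rewrite xE scalerBr; apply: dir_coef_eq0_sub => i1 i2 i3.
    have ci0 : 0 <= c^-1 by rewrite invr_ge0 ltW.
    by apply: low => //; do 2?apply: face_add; do ?apply: face_scale.
  - move=> t t0 tmu; have := zmu t t0 tmu; rewrite line_polyE opprK.
    by rewrite scaleNr addrC.
  - have -> : c^-1 *: x + e = c^-1 *: (x + c *: e).
      by rewrite scalerDr scalerA mulVf ?gt_eqF // scale1r.
    by apply: cone_scale => //; rewrite invr_gt0.
  - exact: FK.
have Fx : F (mu *: (c^-1 *: x) + z).
  (* The point is a difference of two elements of F that lies in the cone, so [face_sub] applies. *)
  have E : mu *: (c^-1 *: x) + z = mu *: (c^-1 *: a) + z - mu *: (c^-1 *: b).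
    by rewrite xE !scalerBr addrAC.
  have ci0 : 0 <= c^-1 by rewrite invr_ge0 ltW.
  rewrite E; apply: face_sub; last by rewrite -E.
    by apply: face_add => //; do 2?apply: face_scale => //; exact: ltW.
  by do 2?apply: face_scale => //; exact: ltW.
have cmu0 : 0 <= c / mu by rewrite divr_ge0 ?(ltW c0) ?(ltW mu0).
(* Rescaling by c / mu gives a point of F at distance (c / mu) N(z) from x. *)
have {}Fx : F (x + (c / mu) *: z).
  have -> : x + (c / mu) *: z = (c / mu) *: (mu *: (c^-1 *: x) + z).
    by rewrite scalerDr !scalerA mulfVK ?gt_eqF // mulfV ?gt_eqF // scale1r.
  exact: face_scale.
apply: le_trans (dist_le x Fx) _.
rewrite opprD addNKr is_normN // NZ (ger0_norm cmu0).
rewrite /kappa mulrDl mul1r; apply: (@le_trans _ _ (N z / (mu * r) * N (x - y))).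
  by rewrite /c invfM le_eqVlt; apply/orP; left; apply/eqP; ring.
by rewrite lerDl.
Qed.

End Face.
End Amenability.

Theorem theorem1p1 (R : realType) (n d : nat) (N : 'rV[R]_n -> R)
    (p : mpoly n R) (e : 'rV[R]_n)
    (normN : is_norm N) (homp : homogeneous d p) (hypp : hyperbolic p e) :
  amenable N (hyperbolicity_cone p e).
Proof.
move=> F faceF F0; exact: (face_error_bound normN homp hypp faceF F0).
Qed.
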